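(* There exists a weight $w=(w_n)_{n\ge1}$ such that the weighted backward shift $B_w$, acting (as a bounded operator) on $c_0$ endowed with the coordinatewise product, supports a frequently hypercyclic algebra.
   Context: $c_0$ is the Banach space of complex sequences $(x_n)_{n\ge0}$ tending to $0$, with the sup norm; the coordinatewise product is $(x_n)\cdot(y_n)=(x_ny_n)$. A weight is a sequence $w=(w_n)_{n\ge1}$ of nonzero complex numbers, and $B_w(x_0,x_1,\dots)=(w_1x_1,w_2x_2,\dots)$. A vector $x\in X$ is frequently hypercyclic for a continuous linear operator $T$ on $X$ if, for every non-empty open $U\subset X$, the set $\{n\in\mathbb N:T^nx\in U\}$ has positive lower density. A frequently hypercyclic algebra for $T$ is a subalgebra of $X$, different from $\{0\}$ and not required to be unital, all of whose nonzero elements are frequently hypercyclic vectors for $T$. *)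

(* Defs.v *)
From HB Require Import structures.
From mathcomp Require Import all_boot all_order all_algebra.
From mathcomp Require Import all_classical all_reals all_analysis.
From mathcomp.real_closed Require Import complex.

Set Implicit Arguments.
Unset Strict Implicit.
Unset Printing Implicit Defensive.

Import Order.TTheory GRing.Theory Num.Theory.
Import numFieldNormedType.Exports.

Local Open Scope classical_set_scope.
Local Open Scope ring_scope.
Local Open Scope complex_scope.

(* The field of complex numbers is R[i] for R : realType; the alias R[i]^o
   carries its usual topology and its structure of normed space over R[i]. *)

Definition c0_seq (R : realType) : {pred (nat -> R[i]^o)} :=
  fun u => `[< u @ \oo --> (0 : R[i]^o) >].

Record c0 (R : realType) := C0 {
  c0_val :> nat -> R[i]^o ;
  c0_valP : c0_val \in @c0_seq R }.

Section C0Space.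
Context {R : realType}.
Local Notation C := R[i].

Lemma c0_seqP (u : nat -> C^o) :
  reflect (u @ \oo --> (0 : C^o)) (u \in @c0_seq R).
Proof. exact: asboolP. Qed.

HB.instance Definition _ := [isSub of c0 R for @c0_val R].
HB.instance Definition _ := [Choice of c0 R by <:].

Lemma c0_submod_closed : submod_closed (@c0_seq R).
Proof.
split=> [|a u v /c0_seqP u0 /c0_seqP v0]; apply/c0_seqP.
  exact: (@cvg_cst C^o).
rewrite -[X in _ --> X](addr0 (0 : C^o)); apply: cvgD => //.
rewrite -[X in _ --> X](scaler0 _ (a : C)).
exact: cvgZl_tmp.
Qed.

HB.instance Definition _ :=
  GRing.isSubmodClosed.Build C _ (@c0_seq R) c0_submod_closed.
HB.instance Definition _ := [SubChoice_isSubLmodule of c0 R by <:].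

Implicit Types x y : c0 R.

Lemma c0_addE x y n : (x + y) n = x n + y n. Proof. by []. Qed.
Lemma c0_scaleE (a : C) x n : (a *: x) n = a * x n. Proof. by []. Qed.
Lemma c0_0E n : (0 : c0 R) n = 0. Proof. by []. Qed.

Lemma c0_ext x y : (forall n, x n = y n) -> x = y.
Proof. by move=> xy; apply/val_inj/funext. Qed.

Definition c0_norm x : R := sup [set Normc.normc (x n) | n in [set: nat]].

Lemma c0_normc_has_sup x :
  has_sup [set Normc.normc (x n) | n in [set: nat]].
Proof.
split; first by exists (Normc.normc (x 0)); exists 0%N.
have FF : ProperFilter (globally [set: nat]).
  exact: (@globally_properfilter _ _ 0%N).
have /c0_seqP/cvgP/(@cvg_seq_bounded C C^o) := c0_valP x.
move=> /ex_bound[M xM]; exists (complex.Re M) => _ [n _ <-].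
have : `|x n| <= M by apply: xM.
by rewrite lecE => /andP[].
Qed.

Lemma normc_le_c0_norm x n : Normc.normc (x n) <= c0_norm x.
Proof. by apply: (sup_upper_bound (c0_normc_has_sup x)); exists n. Qed.

Lemma c0_norm_le x (M : R) :
  (forall n, Normc.normc (x n) <= M) -> c0_norm x <= M.
Proof.
move=> xM; apply: ge_sup; first by case: (c0_normc_has_sup x).
by move=> _ [n _ <-].
Qed.

Lemma normc_ge0 (z : C) : 0 <= Normc.normc z.
Proof. by case: z => a b; exact: sqrtr_ge0. Qed.

Lemma c0_norm_ge0 x : 0 <= c0_norm x.
Proof. exact: le_trans (normc_ge0 (x 0%N)) (normc_le_c0_norm x 0). Qed.

Lemma c0_normD x y : (c0_norm (x + y))%:C <= (c0_norm x)%:C + (c0_norm y)%:C.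
Proof.
rewrite -rmorphD lecR; apply: c0_norm_le => n; rewrite c0_addE.
by rewrite (le_trans (le_normcD _ _))// lerD ?normc_le_c0_norm.
Qed.

Lemma c0_normZ (a : C) x : (c0_norm (a *: x))%:C = `|a| * (c0_norm x)%:C.
Proof.
rewrite -[`|a|]/((Normc.normc a)%:C) -rmorphM; congr (_ %:C).
have leZ (b : C) y : c0_norm (b *: y) <= Normc.normc b * c0_norm y.
  apply: c0_norm_le => n; rewrite c0_scaleE Normc.normcM.
  by rewrite ler_wpM2l ?normc_ge0 ?normc_le_c0_norm.
apply/eqP; rewrite eq_le leZ /=.
have [->|a0] := eqVneq a 0.
  by rewrite Normc.normc0 mul0r c0_norm_ge0.
have na : 0 < Normc.normc a.
  rewrite lt_neqAle normc_ge0 andbT eq_sym.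
  by apply: contra_neq a0 => /Normc.eq0_normc.
rewrite -ler_pdivlMl// -Normc.normcV.
by rewrite -[x in c0_norm x <= _](scalerK a0) leZ.
Qed.

Lemma c0_norm_eq0 x : (c0_norm x)%:C = 0 -> x = 0.
Proof.
move=> /(congr1 (@complex.Re R)) /= x0; apply: c0_ext => n.
apply: Normc.eq0_normc; apply/eqP; rewrite eq_le normc_ge0 andbT -x0.
exact: normc_le_c0_norm.
Qed.

HB.instance Definition _ :=
  @Lmodule_isNormed.Build C (c0 R) (fun x => (c0_norm x)%:C)
    c0_normD c0_normZ c0_norm_eq0.

Lemma c0_normE x :
  `|x| = (sup [set Normc.normc (x n) | n in [set: nat]])%:C.
Proof. by []. Qed.

Lemma c0_mul_subproof x y : (fun n => x n * y n : C^o) \in @c0_seq R.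
Proof.
apply/c0_seqP; rewrite -[X in _ --> X](mulr0 (0 : C)).
by apply: (@cvgM C); apply/c0_seqP/c0_valP.
Qed.

Definition c0_mul x y : c0 R := C0 (c0_mul_subproof x y).

End C0Space.

Section FrequentHypercyclicity.

Definition lower_density (R : realType) (A : set nat) : R :=
  limn_inf (fun n => #|[pred i : 'I_n | `[< A i >]]|%:R / n%:R : R^o).

Definition frequently_hypercyclic (R : realType) (X : topologicalType)
    (T : X -> X) (x : X) : Prop :=
  forall U : set X, open U -> U !=set0 ->
    0 < lower_density R [set n | U (iter n T x)].

Definition subalgebra (K : pzRingType) (X : lmodType K) (mul : X -> X -> X)
    (A : set X) : Prop :=
  [/\ A 0,
      forall x y, A x -> A y -> A (x + y),
      forall (a : K) x, A x -> A (a *: x)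
    & forall x y, A x -> A y -> A (mul x y)].

Definition frequently_hypercyclic_algebra (R : realType)
    (X : normedModType R[i]) (mul : X -> X -> X) (T : X -> X) (A : set X) :=
  [/\ subalgebra mul A,
      A <> [set 0]
    & forall x, A x -> x <> 0 -> frequently_hypercyclic R T x].

End FrequentHypercyclicity.

(* The value w 0 is never used. *)
Definition weight (R : realType) (w : nat -> R[i]) : Prop :=
  forall n, (1 <= n)%N -> w n != 0.

Definition backward_shift (R : realType) (w u : nat -> R[i]) : nat -> R[i] :=
  fun n => w n.+1 * u n.+1.

(* Main.v *)
From HB Require Import structures.
Require Import Defs.
From mathcomp Require Import all_boot all_order all_algebra.
From mathcomp Require Import all_classical all_reals all_analysis.
From mathcomp.real_closed Require Import complex.
From mathcomp Require Import zify ring lra.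
Import Order.TTheory Num.Theory.
Import GRing.Theory numFieldNormedType.Exports.
Local Open Scope classical_set_scope.
Local Open Scope ring_scope.
Local Open Scope complex_scope.

(** Take w_n = (n + 1) / n, so that
    (B_w^n x)_k = (n + k + 1) / (k + 1) * x_(n+k), and let A
    consist of the P(x) with P(0) = 0, for one vector x of c_0.
    Writing P = X^m Q with Q(0) <> 0, the values Q(x_(n+k)) tend to Q(0)
    uniformly in k as n grows, so it is enough that every power x^m (m >= 1) is
    frequently hypercyclic.
    The window [4^j, 2 * 4^j) is devoted to one power m, one finitely supported
    target s and one period g, all encoded in the 2-adic valuation of j: along
    the window, x^m repeats every g steps the block s_k * (k + 1) / (N + 1),
    N being the index, which B_w^n turns into s when n is the start of a block.
    The coordinates of B_w^n x^m beyond that block are small: those coming from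
    the same window have a denominator k + 1 > g, and those coming from later
    windows satisfy (n + k + 1) / (k + 1) <= 2 while x_(n+k) tends to 0.
    Each valuation occurs along an arithmetic progression of j, which gives the
    block starts a positive lower density. *)

(** * Windows, 2-adic valuations and counting *)

Lemma leq_poly_exp4 (M m : nat) :
  exists J, forall j, (J <= j)%N -> (M * j.+1 ^ m <= 4 ^ j)%N.
Proof.
exists (M * m.+1 ^ m.+1)%N => j Jj.
(* This uses one factor of 4^j = 2^j * 2^j; the other absorbs the constants. *)
have h : (j.+1 ^ m <= m.+1 ^ m.+1 * 2 ^ j)%N.
  have step1 : (j.+1 <= m.+1 * 2 ^ (j %/ m.+1))%N.
    rewrite (@leq_trans (m.+1 * (j %/ m.+1).+1))//.
      by rewrite mulnC ltn_ceil.
    by rewrite leq_mul2l /= ltn_expl.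
  rewrite (@leq_trans ((m.+1 * 2 ^ (j %/ m.+1)) ^ m.+1))//.
    by rewrite (@leq_trans (j.+1 ^ m.+1)) ?leq_exp2r ?leq_pexp2l.
  by rewrite expnMn leq_mul2l -expnM leq_exp2l// leq_divM orbT.
rewrite (@leq_trans (M * (m.+1 ^ m.+1 * 2 ^ j)))// ?leq_mul2l ?h ?orbT//.
by rewrite mulnA (expnMn 2 2) leq_mul2r (leq_trans Jj) ?orbT// ltnW// ltn_expl.
Qed.

(** The j of valuation c are the odd multiples of 2^c, so consecutive ones differ by 2^(c+1). *)
Lemma logn2_syndetic (c J : nat) : (2 ^ c <= J)%N ->
  exists2 j, (j <= J < j + 2 ^ c.+1)%N & logn 2 j = c.
Proof.
move=> cJ; pose s := ((J - 2 ^ c) %/ 2 ^ c.+1)%N.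
exists (2 ^ c * s.*2.+1)%N.
  have := leq_divM (J - 2 ^ c) (2 ^ c.+1).
  have := @ltn_ceil (J - 2 ^ c) (2 ^ c.+1).
  rewrite expn_gt0 -/s => /(_ isT).
  rewrite expnS; nia.
by rewrite lognM ?expn_gt0// pfactorK// lognE /= dvdn2 /= odd_double addn0.
Qed.

Lemma card_progression (A : pred nat) (a g q n : nat) :
  (0 < g)%N -> (a + q * g <= n)%N ->
  (forall t, (t < q)%N -> A (a + t * g)%N) ->
  (q <= #|[pred i : 'I_n | A i]|)%N.
Proof.
move=> g0 aqn At.
have lt_n (t : 'I_q) : (a + t * g < n)%N by have := ltn_ord t; nia.
pose f t := Ordinal (lt_n t).
have finj : injective f.
  by move=> t t' /(congr1 val) /= h; apply: val_inj => /=; nia.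
rewrite -[X in (X <= _)%N]card_ord -(card_codom finj) subset_leq_card//.
by apply/fintype.subsetP => _ /codomP[t ->]; rewrite inE At.
Qed.

(** A single window suffices: for large n, some j of valuation c has its window below n and 4^j at
    least n / 4^(L+2), and at least 4^j / (2 (g+1)) points of that window are in [A]. *)
Lemma window_progressions_count (A : pred nat) (c g J0 : nat) :
  (forall j t, (J0 <= j)%N -> logn 2 j = c -> (t.+1 * g.+1 <= 4 ^ j)%N ->
    A (4 ^ j + t * g.+1)%N) ->
  exists K n0, forall n, (n0 <= n)%N ->
    (n <= K * #|[pred i : 'I_n | A i]|)%N.
Proof.
move=> HA; set L := (2 ^ c.+1)%N.
exists (4 ^ L.+2 * (2 * g.+1))%N, (4 ^ (J0 + g + L + L).+1)%N => n n0n.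
have n_gt0 : (0 < n)%N by rewrite (leq_trans _ n0n)// expn_gt0.
have := trunc_logP (isT : 1 < 4)%N n_gt0.
have := trunc_log_ltn n (isT : 1 < 4)%N.
have := trunc_log_max (isT : 1 < 4)%N n0n.
case: (trunc_log 4 n) => // J; rewrite ltnS => J_ge lt_n le_n.
have [|j /andP[jJ Jj] jc] := @logn2_syndetic c J.
  by rewrite (leq_trans _ J_ge)// /L expnS; lia.
have {Jj} [J0j gj' Jj] : [/\ (J0 <= j)%N, (g <= j)%N & (J < j + L)%N].
  by rewrite -/L in Jj; clear -J_ge Jj; split; lia.
have gj : (g.+1 <= 4 ^ j)%N.
  apply: leq_trans (ltn_expl g (isT : 1 < 4)%N) _.
  by rewrite leq_exp2l.
set q := (4 ^ j %/ g.+1)%N.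
have q_gt0 : (0 < q)%N by rewrite divn_gt0.
have qle : (q * g.+1 <= 4 ^ j)%N by exact: leq_divM.
have qgt : (4 ^ j < q.+1 * g.+1)%N by exact: ltn_ceil.
have jn : (4 ^ j.+1 <= n)%N by rewrite (leq_trans _ le_n)// leq_exp2l.
have nj : (n <= 4 ^ L.+2 * 4 ^ j)%N.
  by rewrite -expnD (leq_trans (ltnW lt_n))// leq_exp2l//; clear -Jj; lia.
have qA : (q <= #|[pred i : 'I_n | A i]|)%N.
  apply: (@card_progression A (4 ^ j) g.+1) => //.
    by rewrite expnS in jn; clear -jn qle; lia.
  move=> t tq; apply: HA => //; apply: leq_trans qle.
  by rewrite leq_mul2r tq orbT.
apply: leq_trans nj _; rewrite -mulnA leq_mul2l; apply/orP; right.
rewrite (@leq_trans (2 * g.+1 * q))//; first by clear -qgt q_gt0; nia.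
by rewrite leq_mul2l qA orbT.
Qed.

Lemma lower_density_gt0 (R : realType) (A : set nat) (K n0 : nat) :
  (forall n, (n0 <= n)%N -> (n <= K * #|[pred i : 'I_n | `[< A i >]]|)%N) ->
  0 < lower_density R A.
Proof.
move=> HK; rewrite /lower_density; set u := fun n : nat => _.
have u01 n : 0 <= u n <= 1.
  rewrite /u divr_ge0 //=; have [->|n_gt0] := posnP n.
    by rewrite invr0 mulr0 ler01.
  rewrite ler_pdivrMr ?ltr0n// mul1r ler_nat.
  by rewrite -[leqRHS]card_ord max_card.
have ub : bounded_fun u.
  exists 1; split => // M M1 n _ /=.
  by have /andP[u0 u1] := u01 n; rewrite ger0_norm// (le_trans u1)// ltW.
rewrite limn_infE//.
have lb n : has_lbound (sdrop u n).
  by exists 0 => _ [k _ <-]; case/andP: (u01 k).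
have K_gt0 : (0 < K)%N.
  have := HK n0.+1 (leqnSn _); case: (K) => //.
apply: (@lt_le_trans _ _ (K%:R^-1 : R)); first by rewrite invr_gt0 ltr0n.
(* The tail starts at [n0.+1] to leave out n = 0, where the quotient is 0 by convention. *)
apply: (@le_trans _ _ (infs u n0.+1)).
  apply: lb_le_inf; first by exists (u n0.+1), n0.+1 => /=.
  move=> _ [k /= n0k <-]; rewrite /u.
  have k_gt0 : (0 < k)%N by exact: leq_trans n0k.
  rewrite ler_pdivlMr ?ltr0n// ler_pdivrMl ?ltr0n// -natrM ler_nat.
  by apply: HK; apply: ltnW.
apply: ub_le_sup; last by exists n0.+1.
exists 1 => _ [n _ <-]; case/andP: (u01 n) => _; apply: le_trans.
by apply: ge_inf => //; exists n => /=.
Qed.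

(** * Estimates over [R[i]] and in [c0] *)

(** Being positive in [R[i]] includes being real, so the archimedean property of [R] applies. *)
Lemma complex_archi (R : realType) (e : R[i]) : 0 < e ->
  exists n : nat, n.+1%:R^-1 < e.
Proof.
move=> e0; have /RRe_real ee := gtr0_real e0; rewrite -ee ltcR in e0 *.
exists (Num.bound (complex.Re e)^-1).
rewrite -(rmorph_nat (real_complex R)) -fmorphV ltcR invf_plt ?posrE//.
apply: lt_trans (archi_boundP _) _; first by rewrite invr_ge0 ltW.
by rewrite ltr_nat.
Qed.

Lemma complex_le_nat (R : realType) (z : R[i]) : exists n : nat, `|z| <= n%:R.
Proof.
have z1 : 0 < `|z| + 1 by rewrite ltr_wpDl.
have [|n] := @complex_archi R (`|z| + 1)^-1; first by rewrite invr_gt0.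
rewrite ltf_pV2 ?posrE// => zn; exists n.+1.
by rewrite (le_trans _ (ltW zn))// lerDl.
Qed.

Lemma c0_norm_le_complex (R : realType) (x : c0 R) (e : R[i]) :
  (forall k, `|x k : R[i]| <= e) -> `|x| <= e.
Proof.
move=> xe; have /RRe_real ee : e \is Num.real.
  by rewrite ger0_real// (le_trans _ (xe 0%N)).
rewrite c0_normE -ee lecR; apply: c0_norm_le => k.
by rewrite -lecR ee; exact: xe.
Qed.

Lemma c0_coord_le (R : realType) (x : c0 R) k : `|x k : R[i]| <= `|x|.
Proof.
rewrite c0_normE -[leLHS]/((Normc.normc (x k))%:C) lecR.
exact: normc_le_c0_norm.
Qed.

Lemma c0_seq_intro (R : realType) (u : nat -> R[i]^o) :
  (forall e : R[i], 0 < e -> exists N, forall k, (N <= k)%N ->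
    `|u k : R[i]| <= e) -> u \in @c0_seq R.
Proof.
move=> H; apply/c0_seqP/cvgr0Pnorm_le => e e0.
have [N HN] := H e e0.
by exists N => // k /=; exact: HN.
Qed.

Lemma c0_small (R : realType) (x : c0 R) (e : R[i]) : 0 < e ->
  exists N, forall k, (N <= k)%N -> `|x k : R[i]| <= e.
Proof.
move=> e0; have /c0_seqP/cvgr0Pnorm_le/(_ e e0)[N _ HN] := c0_valP x.
by exists N => k; exact: HN.
Qed.

(** * A countable dense family of targets *)

(** Pairs of rationals are used so that lists of them have codes under [pickle]. *)
Definition ratC (R : realType) (p : rat * rat) : R[i] :=
  Complex (ratr p.1) (ratr p.2).

Lemma ratC_dense (R : realType) (z : R[i]) (e : R[i]) : 0 < e ->
  exists p, `|ratC R p - z| <= e.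
Proof.
move=> e0; have /RRe_real ee := gtr0_real e0; rewrite -ee ltcR in e0 *.
move: (complex.Re e) e0 => {ee}e e0; case: z => a b.
have near (r : R) : exists q : rat, `|ratr q - r| <= e / 2.
  have [|q] := @rat_in_itvoo R (r - e / 2) (r + e / 2); first by lra.
  rewrite in_itv/= => /andP[q1 q2]; exists q.
  by rewrite ler_norml; apply/andP; split; lra.
have [p ap] := near a; have [q bq] := near b.
exists (p, q); rewrite /ratC /=.
set c := ratr p - a in ap; set d := ratr q - b in bq.
have -> : Complex (ratr p) (ratr q) - Complex a b =
    (Complex c 0 + Complex 0 d)%R.
  by apply/eqP; rewrite eq_complex /= ?addr0 ?add0r !eqxx.
rewrite (le_trans (ler_normD _ _))// [e in leRHS](splitr e) rmorphD lerD//.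
  by rewrite normc_def /= expr0n addr0 lecR sqrtr_sqr.
by rewrite normc_def /= expr0n add0r lecR sqrtr_sqr.
Qed.

Definition ratC_seq (R : realType) (s : seq (rat * rat)) (k : nat) : R[i] :=
  ratC R (nth (0, 0) s k).

Lemma ratC_seq_default (R : realType) s k :
  (size s <= k)%N -> ratC_seq R s k = 0.
Proof. by move=> sk; rewrite /ratC_seq nth_default// /ratC /= rmorph0. Qed.

Lemma ratC_seq_dense (R : realType) (y : c0 R) (e : R[i]) : 0 < e ->
  exists s, forall k, `|ratC_seq R s k - y k| <= e.
Proof.
move=> e0; have [N yN] := c0_small R y e e0.
have [f fy] := choice (fun k => ratC_dense R (y k) e e0).
exists (mkseq f N) => k; have [kN|Nk] := ltnP k N.
  by rewrite /ratC_seq nth_mkseq.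
by rewrite ratC_seq_default ?size_mkseq// sub0r normrN yN.
Qed.

(** [M] decides both when the cut-off in [seed] becomes inactive and how long the period must be. *)
Lemma ratC_seq_bound (R : realType) s :
  exists M : nat, forall k, `|ratC_seq R s k * k.+1%:R| <= M%:R.
Proof.
suff [M HM] : exists M : nat, forall k, (k < size s)%N ->
    `|ratC_seq R s k * k.+1%:R| <= M%:R.
  exists M => k; have [/HM//|sk] := ltnP k (size s).
  by rewrite ratC_seq_default// mul0r normr0 ler0n.
elim: (size s) => [|n [M HM]]; first by exists 0%N.
have [M' HM'] := complex_le_nat R (ratC_seq R s n * n.+1%:R).
exists (M + M')%N => k; rewrite ltnS leq_eqVlt => /predU1P[->|kn].
  by rewrite (le_trans HM')// ler_nat leq_addl.
by rewrite (le_trans (HM _ kn))// ler_nat leq_addr.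
Qed.

(** * The vector [seed] *)

(** Exponent [m.+1] and period [g.+1] are positive for every decoded triple; a number that is no
    code yields the zero block. *)
Definition block_root (R : realType) (N : nat) : R[i] :=
  let j := trunc_log 4 N in
  let: (m, s, g) :=
    odflt (0%N, [::] : seq (rat * rat), 0%N) (unpickle (logn 2 j)) in
  let k := ((N - 4 ^ j) %% g.+1)%N in
  if (N < 2 * 4 ^ j)%N then
    m.+1.-root (ratC_seq R s k * k.+1%:R / N.+1%:R) else 0.

(* The cut-off makes seed tend to 0 at once; for a given (m, s, g) it is
   eventually inactive, the m.+1-th powers of the roots being O(4^-j). *)
Definition seed (R : realType) (N : nat) : R[i] :=
  let z := block_root R N in
  if `|z| <= (trunc_log 4 N).+1%:R^-1 then z else 0.

Lemma seed_le (R : realType) N : `|seed R N| <= (trunc_log 4 N).+1%:R^-1.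
Proof. by rewrite /seed; case: ifP => //; rewrite normr0 invr_ge0 ler0n. Qed.

Lemma seed_c0 (R : realType) : (seed R : nat -> R[i]^o) \in @c0_seq R.
Proof.
apply: c0_seq_intro => e e0; have [n ne] := complex_archi R e e0.
exists (4 ^ n)%N => k nk; apply: le_trans (seed_le R k) _.
apply: le_trans (ltW ne); rewrite lef_pV2 ?posrE ?ltr0n// ler_nat ltnS.
exact: trunc_log_max.
Qed.

(** These empty gaps force k to be at least i whenever i lies in a window and i + k in a later
    one. *)
Lemma seed_gap (R : realType) j N :
  (2 * 4 ^ j <= N < 4 ^ j.+1)%N -> seed R N = 0.
Proof.
move=> /andP[jN Nj]; have jE : trunc_log 4 N = j.
  by apply: trunc_log_eq => //; rewrite Nj andbT (leq_trans _ jN)// leq_pmull.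
rewrite /seed /block_root jE; case: (odflt _ _) => -[m s] g.
by rewrite ltnNge jN /= if_same.
Qed.

Lemma seed_block (R : realType) m s g : exists J, forall j i, (J <= j)%N ->
  logn 2 j = pickle (m, s, g) -> (i < 4 ^ j)%N ->
  seed R (4 ^ j + i)%N ^+ m.+1 =
    ratC_seq R s (i %% g.+1)%N * (i %% g.+1).+1%:R / (4 ^ j + i).+1%:R.
Proof.
have [M HM] := ratC_seq_bound R s; have [J HJ] := leq_poly_exp4 M m.+1.
exists J => j i Jj jc ij.
have jE : trunc_log 4 (4 ^ j + i) = j.
  by apply: trunc_log_eq => //; rewrite expnS; clear -ij; lia.
rewrite /seed /block_root jE jc pickleK /= addKn mulSn mul1n ltn_add2l ij.
set v := _ / _; rewrite ifT ?rootCK//.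
(* The cut-off is tested on (m+1)-th powers, where [leq_poly_exp4] gives M / 4^j <= (j+1)^-(m+1). *)
rewrite -(@ler_pXn2r _ m.+1)// ?nnegrE ?invr_ge0 ?ler0n// -normrX rootCK//.
rewrite /v normrM normfV normr_nat ler_pdivrMr ?ltr0n//.
apply: le_trans (HM _) _; rewrite exprVn ler_pdivlMl ?exprn_gt0 ?ltr0n//.
rewrite -natrX -natrM ler_nat mulnC (leq_trans (HJ _ Jj))//; clear; lia.
Qed.

(** By [iter_shift], this compares coordinate k of the i-th iterate of [shift] at the (m+1)-th power
    of [seed] with the target. *)
Definition seed_close (R : realType) m s (e : R[i]) (i : nat) : Prop :=
  forall k, `|(i + k).+1%:R / k.+1%:R * seed R (i + k)%N ^+ m.+1
              - ratC_seq R s k| <= e.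

(** Block starts provide the times; [n1 <= i] is kept so that the cofactor of a polynomial is
    already near its limit there. *)
Lemma seed_approx (R : realType) m s (e : R[i]) n1 : 0 < e ->
  exists K n0, forall n, (n0 <= n)%N ->
    (n <= K *
      #|[pred i : 'I_n | (n1 <= i)%N && `[< seed_close R m s e i >] ]|)%N.
Proof.
move=> e0; have [M HM] := ratC_seq_bound R s.
have [r re] := complex_archi R e e0.
(* The period exceeds [size s], so a block holds all of s, and M (r+1), so later copies of the block
   contribute at most M / (k+1) < 1 / (r+1). *)
pose g := (size s + M * r.+1)%N.
have [J HJ] := seed_block R m s g.
(* [J] serves [seed_block], [n1] gives n1 <= j <= i, and 2 (r+1) makes 2 / (j+1) at most 1 /
   (r+1). *)
pose J0 := (J + n1 + 2 * r.+1)%N.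
pose A := [pred i : nat | (n1 <= i)%N && `[< seed_close R m s e i >] ].
apply: (@window_progressions_count A (pickle (m, s, g)) g J0) => j t J0j jc tg.
apply/andP; split.
  rewrite (@leq_trans j)//; first by rewrite /J0 in J0j; clear -J0j; lia.
  by rewrite (leq_trans (ltnW (ltn_expl j (isT : 1 < 4)%N)))// leq_addr.
apply/asboolP => k; set i := (4 ^ j + t * g.+1)%N.
have k1 : (0 : R[i]) < k.+1%:R by rewrite ltr0n.
have [iN|Ni] := ltnP (t * g.+1 + k) (4 ^ j).
  have -> : (i + k = 4 ^ j + (t * g.+1 + k))%N by rewrite addnA.
  rewrite (HJ _ _ _ jc iN) ?modnMDl;
    last by rewrite /J0 in J0j; clear -J0j; lia.
  set k' := (k %% g.+1)%N; set N := (_ + (_ + k))%N.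
  have -> : N.+1%:R / k.+1%:R * (ratC_seq R s k' * k'.+1%:R / N.+1%:R)
      = ratC_seq R s k' * k'.+1%:R / k.+1%:R :> R[i].
    by rewrite mulrC mulrA divfK ?pnatr_eq0.
  have [kg|gk] := ltnP k g.+1.
    rewrite /k' modn_small// mulfK ?gt_eqF// subrr normr0.
    exact: ltW.
  rewrite [X in _ - X]ratC_seq_default;
    last by clear -gk; rewrite /g in gk; lia.
  rewrite subr0 normrM normfV (ger0_norm (ltW k1)) ler_pdivrMr//.
  apply: le_trans (HM _) _; apply: (@le_trans _ _ (r.+1%:R^-1 * k.+1%:R)).
    rewrite ler_pdivlMl ?ltr0n// -natrM ler_nat.
    by clear -gk; rewrite /g in gk; lia.
  by rewrite ler_wpM2r ?ler0n// ltW.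
have gk : (g.+1 <= k)%N by clear -Ni tg; rewrite mulSn in tg; lia.
rewrite [X in _ - X]ratC_seq_default; last by clear -gk; rewrite /g in gk; lia.
rewrite subr0.
have [Ns|sN] := ltnP (i + k) (4 ^ j.+1).
  rewrite (seed_gap _ j) ?expr0n ?mulr0 ?normr0 ?(ltW e0)//.
  by rewrite Ns andbT /i; clear -Ni; lia.
have le2 : `|(i + k).+1%:R / k.+1%:R| <= 2 :> R[i].
  rewrite ger0_norm ?divr_ge0 ?ler0n// ler_pdivrMr// -natrM ler_nat.
  rewrite expnS in sN; rewrite /i in sN *; clear -sN tg.
  by rewrite mulSn in tg; lia.
have jN : (j < trunc_log 4 (i + k))%N by exact: trunc_log_max.
have le1 : `|seed R (i + k)%N ^+ m.+1| <= `|seed R (i + k)%N|.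
  rewrite normrX ler_iXnr//; apply: le_trans (seed_le _ _) _.
  by rewrite invf_le1 ?ltr0n// ler1n.
rewrite normrM; apply: (@le_trans _ _ (2 * (j.+1%:R)^-1)).
  apply: ler_pM => //; apply: le_trans le1 (le_trans (seed_le _ _) _).
  by rewrite lef_pV2 ?posrE ?ltr0n// ler_nat ltnS ltnW.
apply: le_trans (ltW re); rewrite ler_pdivrMr ?ltr0n//.
rewrite ler_pdivlMl ?ltr0n// -natrM ler_nat.
by rewrite /J0 in J0j; clear -J0j; lia.
Qed.

(** * The weighted shift on [c0] *)

Lemma shift_c0 (R : realType) (x : c0 R) :
  (backward_shift (fun n => n.+1%:R / n%:R) (c0_val x) : nat -> R[i]^o)
    \in @c0_seq R.
Proof.
apply: c0_seq_intro => e e0; have [|N HN] := c0_small R x (e / 2).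
  by rewrite divr_gt0.
exists N => k Nk; rewrite /backward_shift normrM.
rewrite -(divfK (_ : 2 != 0) e)  ?pnatr_eq0// mulrC ler_pM//.
  by apply: HN; rewrite ltnW.
rewrite ger0_norm ?divr_ge0 ?ler0n// ler_pdivrMr ?ltr0n// -natrM ler_nat; lia.
Qed.

Definition shift (R : realType) (x : c0 R) : c0 R := C0 (shift_c0 R x).

Lemma shift_linear (R : realType) : linear (@shift R).
Proof.
move=> a x y; apply: c0_ext => n.
set w : R[i] := n.+2%:R / n.+1%:R.
by change (w * (a * x n.+1 + y n.+1) = a * (w * x n.+1) + w * y n.+1); ring.
Qed.

HB.instance Definition _ (R : realType) :=
  GRing.isLinear.Build R[i] (c0 R) (c0 R) _ (@shift R) (shift_linear R).

Lemma shift_continuous (R : realType) : continuous (@shift R).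
Proof.
apply/linear_bounded_continuous/linear_boundedP; exists 2; split => // r r2 x.
apply: c0_norm_le_complex => k /=; rewrite normrM.
apply: ler_pM; rewrite ?normr_ge0 ?c0_coord_le//; apply: le_trans (ltW r2).
rewrite ger0_norm ?divr_ge0 ?ler0n// ler_pdivrMr ?ltr0n// -natrM ler_nat; lia.
Qed.

(** The product of the weights of index k+1 to k+n telescopes. *)
Lemma iter_shift (R : realType) n (x : c0 R) k :
  iter n (@shift R) x k = (n + k).+1%:R / k.+1%:R * x (n + k)%N.
Proof.
elim: n k => [|n IHn] k; first by rewrite divff ?mul1r// pnatr_eq0.
rewrite iterS [LHS]/= /backward_shift IHn addnS mulrA; congr (_ * _).
by rewrite mulrC mulrA divfK// pnatr_eq0.
Qed.

(** * Polynomials in [seed] *)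

Lemma cvg_horner (K : numFieldType) (u : nat -> K^o) (l : K^o) (p : {poly K}) :
  u @ \oo --> l -> (fun n => p.[u n] : K^o) @ \oo --> (p.[l] : K^o).
Proof.
move=> ul; elim/poly_ind: p => [|p c IHp].
  by under eq_fun do rewrite horner0; rewrite horner0; exact: cvg_cst.
under eq_fun do rewrite hornerMXaddC; rewrite hornerMXaddC.
by apply: (@cvgD K K^o); [exact: cvgM | exact: cvg_cst].
Qed.

(** In use, a is a coordinate of the target divided by c, b its rational approximation, v that
    coordinate of the shifted power of [seed], and d the cofactor near its limit c. *)
Lemma le_norm_subM (K : numDomainType) (a b c d v h : K) :
  h <= 1 -> `|b - a| <= h -> `|v - b| <= h -> `|d - c| <= h ->
  `|c * a - v * d| <= h * (2 * `|c| + (`|a| + 2)).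
Proof.
move=> h1 ba vb dc; have vB : `|v| <= `|a| + 2.
  have -> : v = a + ((b - a) + (v - b)) by ring.
  rewrite (le_trans (ler_normD _ _))// lerD// (le_trans (ler_normD _ _))//.
  by rewrite -[2]/(1 + 1) lerD// ?(le_trans ba)// (le_trans vb).
have -> : c * a - v * d = - (c * ((b - a) + (v - b)) + v * (d - c)) by ring.
rewrite normrN (le_trans (ler_normD _ _))// [leRHS]mulrDr lerD//; last first.
  by rewrite normrM mulrC ler_pM.
have -> : h * (2 * `|c|) = `|c| * (h + h) by ring.
by rewrite normrM ler_wpM2l// (le_trans (ler_normD _ _))// lerD.
Qed.

Lemma poly_seed_frequently_hypercyclic (R : realType) (P : {poly R[i]})
    (z : c0 R) : P != 0 -> P.[0] = 0 ->
  (forall k, z k = P.[seed R k]) -> frequently_hypercyclic R (@shift R) z.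
Proof.
move=> P0 P00 zP U Uo [u Uu].
have [[|m] [q]] := multiplicity_XsubC P 0; rewrite P0 /= => q0 PE.
  by move: q0 P00; rewrite /root PE mulr1 => /negP q0 /eqP.
have zE k : z k = seed R k ^+ m.+1 * q.[seed R k].
  by rewrite zP PE subr0 hornerM hornerXn mulrC.
set c := q.[0]; have cN0 : c != 0 by [].
have /nbhs_ballP[e /= e0 eU] : nbhs u U by apply: open_nbhs_nbhs.
(* The cofactor multiplies the orbit by nearly c, so the power of [seed] has to approach u / c. *)
pose y : c0 R := c^-1 *: u.
have uE k : u k = c * y k.
  by change (u k = c * (c^-1 * u k)); rewrite mulrA divff// mul1r.
pose B := `|y| + 2.
pose D := 2 * `|c| + B.
have B0 : 0 < B by rewrite ltr_wpDl.
have D0 : 0 < D by rewrite ltr_wpDl// mulr_ge0.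
(* [D] is the factor in [le_norm_subM] with [|y|] bounding every coordinate; the form 1 / (n+1) of h
   also gives h <= 1. *)
have [n neD] := complex_archi R (e / D) (divr_gt0 e0 D0).
set h : R[i] := n.+1%:R^-1 in neD.
have h0 : 0 < h by rewrite invr_gt0 ltr0n.
have h1 : h <= 1 by rewrite invf_le1 ?ltr0n// ler1n.
have [s sy] := ratC_seq_dense R y h h0.
have [n1 Hn1] : exists n1, forall k, (n1 <= k)%N ->
    `|q.[seed R k] - c| <= h.
  have /c0_seqP sd0 := seed_c0 R.
  have := cvg_horner R[i] _ _ q sd0.
  move=> /cvgrPdist_le/(_ h h0)[n1 _ Hn1].
  by exists n1 => k /Hn1 /=; rewrite distrC.
have [K [n0 HK]] := seed_approx R m s h n1 h0.
apply: (@lower_density_gt0 R _ K n0) => N /HK /leq_trans; apply.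
rewrite leq_mul2l; apply/orP; right; apply: subset_leq_card.
apply/fintype.subsetP => i; rewrite !inE => /andP[n1i /asboolP Hi].
apply: eU => /=; rewrite -ball_normE /=.
have : h * D < e by rewrite -ltr_pdivlMr.
apply: le_lt_trans; apply: c0_norm_le_complex => k.
rewrite -[_ k]/(u k - iter i (@shift R) z k) iter_shift zE uE.
have := Hi k; have := sy k.
have := Hn1 (i + k)%N (leq_trans n1i (leq_addr _ _)).
have := c0_coord_le R y k.
move=> aB qc ba vb; have := le_norm_subM _ _ _ _ _ _ _ h1 ba vb qc.
rewrite -[X in _ - X]mulrA => /le_trans; apply.
by rewrite ler_wpM2l ?(ltW h0)// lerD2l lerD2r.
Qed.

(** A zero [seed] would never come within 1/2 of the target (1, 0, 0, ...). *)
Lemma seed_neq0 (R : realType) : C0 (seed_c0 R) <> 0.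
Proof.
move=> seed0.
have half : (0 : R[i]) < 2^-1 by rewrite invr_gt0.
have [K [n0 HK]] := seed_approx R 0 [:: (1, 0)] 2^-1 0 half.
have := HK n0.+1 (leqnSn _); rewrite leqNgt => /negP; apply.
rewrite eq_card0 ?muln0// => i; rewrite !inE /=; apply/asboolP => /(_ 0%N).
have -> : seed R (i + 0)%N = 0 by rewrite -[LHS]/(C0 (seed_c0 R) _) seed0.
rewrite expr1 mulr0 sub0r normrN.
have -> : ratC_seq R [:: (1, 0)] 0 = 1.
  by rewrite /ratC_seq /ratC /= rmorph1 rmorph0.
by rewrite normr1 invf_ge1// lern1.
Qed.

Theorem theorem1p6 (R : realType) :
  exists w : nat -> R[i], weight w /\
    exists T : {linear c0 R -> c0 R},
      [/\ continuous T,
          forall x : c0 R, c0_val (T x) = backward_shift w (c0_val x)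
        & exists A : set (c0 R),
            frequently_hypercyclic_algebra (@c0_mul R) T A].
Proof.
exists (fun n => n.+1%:R / n%:R); split.
  by move=> n n1; rewrite mulf_neq0 ?invr_eq0 ?pnatr_eq0 -?lt0n.
exists (@shift R); split => //; first exact: shift_continuous.
(* The subalgebra generated by [seed]; evaluating P in each coordinate avoids powers in the
   non-unital [c0]. *)
exists [set z | exists2 P : {poly R[i]}, P.[0] = 0 &
  forall k, z k = P.[seed R k]]; split.
- split.
  + by exists 0 => [|k]; rewrite horner0.
  + move=> x y [P P0 xP] [Q Q0 yQ]; exists (P + Q) => [|k].
      by rewrite hornerD P0 Q0 addr0.
    by rewrite hornerD -xP -yQ.
  + move=> a x [P P0 xP]; exists (a *: P) => [|k].
      by rewrite hornerZ P0 mulr0.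
    by rewrite hornerZ -xP.
  + move=> x y [P P0 xP] [Q Q0 yQ]; exists (P * Q) => [|k].
      by rewrite hornerM P0 mul0r.
    by rewrite hornerM -xP -yQ.
- move=> A0; apply: (@seed_neq0 R).
  suff : [set 0] (C0 (seed_c0 R)) by [].
  by rewrite -A0; exists 'X => [|k]; rewrite hornerX.
- move=> x [P P0 xP] x0.
  apply: (poly_seed_frequently_hypercyclic R P x _ P0 xP).
  apply/eqP => PE; apply: x0; apply: c0_ext => k.
  by rewrite xP PE horner0.
Qed.
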